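(* The group $\mathbb{Z}\,\mathrm{wr}\,\mathbb{Z}$ is the smallest metabelian group which embeds into itself as a normal distorted subgroup, in the following sense. For any finitely generated metabelian group $G$, if there is an embedding (injective homomorphism) $\phi:G\to G$ such that $\phi(G)\trianglelefteq G$ and $\phi(G)$ is a distorted subgroup of $G$, then there exists some subgroup $H$ of $G$ for which $H\cong\mathbb{Z}\,\mathrm{wr}\,\mathbb{Z}$.
   Context: $\mathbb{Z}\,\mathrm{wr}\,\mathbb{Z}$ is the restricted wreath product. For a group $G$ with finite generating set $T$ and a subgroup $H$ with finite generating set $S$, the distortion function is $\Delta_H^G(l)=\max\{|w|_S : w\in H, |w|_T\le l\}$, where $|\cdot|_S$ and $|\cdot|_T$ are word lengths. For non-decreasing functions $f,g$ on $\mathbb{N}$, $f\preceq g$ means there is an integer $C>0$ with $f(l)\le Cg(Cl)$ for all $l\ge 0$; $f\approx g$ means $f\preceq g$ and $g\preceq f$. A subgroup $H$ is undistorted in $G$ if $\Delta_H^G(l)\approx l$, and distorted otherwise.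
   Formalization: The group G is assumed infinite: for finite G (e.g. trivial G with the identity map) the distortion function is bounded, so φ(G) counts as distorted under the stated definition although G contains no copy of Z wr Z. *)

(* Defs.v *)
From HB Require Import structures.
From mathcomp Require Import all_boot all_order all_algebra.
From mathcomp Require Import boolp classical_sets functions cardinality.

Set Implicit Arguments.
Unset Strict Implicit.
Unset Printing Implicit Defensive.

Local Open Scope classical_set_scope.
Local Open Scope group_scope.

Section Subgroups.
Variable G : groupType.
Implicit Types (H A : set G) (T S : seq G).

Definition subgroup H : Prop := H 1 /\ forall x y, H x -> H y -> H (x / y).

(* [x ^ y] is the conjugate [y^-1 * (x * y)]. *)
Definition normal_subgroup H : Prop :=
  subgroup H /\ forall x y, H x -> H (x ^ y).

Definition generated A : set G := smallest subgroup A.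

Definition finite_generating_set H T : Prop := generated [set` T] = H.

Definition finitely_generated H : Prop := exists T, finite_generating_set H T.

Definition abelian H : Prop := forall x y, H x -> H y -> commute x y.

Definition derived_subgroup : set G :=
  generated [set [~ x, y] | x in [set: G] & y in [set: G]].

End Subgroups.

Arguments derived_subgroup : clear implicits.

Definition metabelian (G : groupType) : Prop := abelian (derived_subgroup G).

Definition isomorphic_to_subgroup (K G : groupType) (H : set G) : Prop :=
  exists f : {multiplicative K -> G}, injective f /\ range f = H.

Section WordLength.
Variable G : groupType.
Implicit Types (H : set G) (S T : seq G) (w : G) (l n : nat).

Definition word_of_length S w n : Prop :=
  exists s : seq G, [/\ size s = n,
    {subset s <= S ++ [seq x^-1 | x <- S]} & \prod_(x <- s) x = w].

(* The value 0 for [w] outside the subgroup generated by [S] is irrelevant. *)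
Definition word_length S w : nat :=
  match pselect (exists n, `[< word_of_length S w n >]) with
  | left h => ex_minn h
  | right _ => 0
  end.

(* The supremum is a maximum, see [distortion_max] below. *)
Definition distortion T H S l : nat :=
  supremum 0 [set word_length S w | w in
                [set w | H w /\ (word_length T w <= l)%N]].

End WordLength.

Definition growth_le (f g : nat -> nat) : Prop :=
  exists2 C, (0 < C)%N & forall l, (f l <= C * g (C * l))%N.

Definition growth_equiv (f g : nat -> nat) : Prop :=
  growth_le f g /\ growth_le g f.

(* Up to [growth_equiv], [distortion T H S] does not depend on the finite
   generating sets [T] and [S]. Degenerate case: if H is finite (for instance
   trivial) then the distortion function is bounded, hence not equivalent to
   [id], and H counts as distorted. *)
Definition distorted (G : groupType) (H : set G) : Prop :=
  exists T S : seq G,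
    [/\ finite_generating_set [set: G] T, finite_generating_set H S
      & ~ growth_equiv (distortion T H S) id].

(* The restricted wreath product A wr B: pairs (f, b) of a finitely supported
   f : B -> A and b : B, with (f, b) (g, c) = (f (b . g), b c), where
   (b . g) x = g (b^-1 x). *)
Record wreath (A B : groupType) := Wreath {
  wreath_fun : B -> A;
  wreath_pos : B;
  wreath_finsupp : finite_set [set x | wreath_fun x <> 1]
}.

Section WreathProduct.
Variables A B : groupType.
Implicit Types u v w : wreath A B.

HB.instance Definition _ := gen_eqMixin (wreath A B).
HB.instance Definition _ := gen_choiceMixin (wreath A B).

Lemma wreath_eq u v :
  wreath_fun u =1 wreath_fun v -> wreath_pos u = wreath_pos v -> u = v.
Proof.
case: u v => [f b fs] [g c gs] /= /funext fg bc.
by subst; congr Wreath; exact: Prop_irrelevance.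
Qed.

Lemma wreath_one_finsupp : finite_set [set x : B | (1 : A) <> 1].
Proof. by rewrite (_ : mkset _ = set0)// -subset0 => x /=. Qed.

Definition wreath_one : wreath A B :=
  @Wreath A B (fun=> 1) 1 wreath_one_finsupp.

Lemma wreath_mul_finsupp u v : finite_set [set x |
  wreath_fun u x * wreath_fun v ((wreath_pos u)^-1 * x) <> 1].
Proof.
apply: (@sub_finite_set _ _ ([set x | wreath_fun u x <> 1] `|`
    [set wreath_pos u * y | y in [set y | wreath_fun v y <> 1]])).
  move=> x /= uv1; have [ux1|ux1] := pselect (wreath_fun u x = 1); last by left.
  right; exists ((wreath_pos u)^-1 * x); last by rewrite mulVKg.
  by move=> vx1; apply: uv1; rewrite ux1 vx1 mulg1.
rewrite finite_setU; split; first exact: wreath_finsupp.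
exact/finite_image/wreath_finsupp.
Qed.

Definition wreath_mul u v : wreath A B :=
  @Wreath A B _ (wreath_pos u * wreath_pos v) (wreath_mul_finsupp u v).

Lemma wreath_inv_finsupp u :
  finite_set [set x | (wreath_fun u (wreath_pos u * x))^-1 <> 1].
Proof.
apply: (@sub_finite_set _ _
    [set (wreath_pos u)^-1 * y | y in [set y | wreath_fun u y <> 1]]).
  move=> x /= ux1; exists (wreath_pos u * x); last by rewrite mulKg.
  by move=> ux; apply: ux1; rewrite ux invg1.
exact/finite_image/wreath_finsupp.
Qed.

Definition wreath_inv u : wreath A B :=
  @Wreath A B _ (wreath_pos u)^-1 (wreath_inv_finsupp u).

Lemma wreath_mulA : associative wreath_mul.
Proof.
by move=> u v w; apply: wreath_eq => [x|]/=; rewrite ?invgM !mulgA.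
Qed.

Lemma wreath_mul1 : left_id wreath_one wreath_mul.
Proof.
by move=> u; apply: wreath_eq => [x|]/=; rewrite ?invg1 !mul1g.
Qed.

Lemma wreath_mulr1 : right_id wreath_one wreath_mul.
Proof. by move=> u; apply: wreath_eq => [x|]/=; rewrite mulg1. Qed.

Lemma wreath_mulV : left_inverse wreath_one wreath_inv wreath_mul.
Proof.
by move=> u; apply: wreath_eq => [x|]/=; rewrite ?invgK mulVg.
Qed.

Lemma wreath_mulVr : right_inverse wreath_one wreath_inv wreath_mul.
Proof.
by move=> u; apply: wreath_eq => [x|]/=; rewrite ?mulVKg mulgV.
Qed.

HB.instance Definition _ := isGroup.Build (wreath A B)
  wreath_mulA wreath_mul1 wreath_mulr1 wreath_mulV wreath_mulVr.

End WreathProduct.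

Definition Zgroup : groupType := Algebra.to_multiplicative int.

Definition ZwrZ : groupType := wreath Zgroup Zgroup.

Section DistortionMax.
Variable G : groupType.
Implicit Types (H : set G) (S T : seq G) (w : G) (l n : nat).

Lemma subgroup_words S :
  subgroup [set w : G | exists n, word_of_length S w n].
Proof.
split; first by exists 0, [::]; split=> //; rewrite big_nil.
move=> x y [m [s [_ sS <-]]] [n [t [_ tS <-]]].
exists (size (s ++ rev [seq z^-1 | z <- t])), (s ++ rev [seq z^-1 | z <- t]).
split=> //.
  move=> z; rewrite mem_cat mem_rev => /orP[/sS//|/mapP[z' /tS + ->]].
  rewrite !mem_cat => /orP[z'S|/mapP[z'' z''S ->]].
    by apply/orP; right; exact: map_f.
  by rewrite invgK z''S.
rewrite big_cat/=; congr (_ * _).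
elim: t {tS} => [|z t ih]; first by rewrite !big_nil invg1.
by rewrite map_cons rev_cons -cats1 big_cat/= ih big_seq1 big_cons invgM.
Qed.

Lemma generated_word S H w : finite_generating_set H S -> H w ->
  exists n, word_of_length S w n.
Proof.
move=> <- /(_ _ (conj (subgroup_words S) _)); apply => x xS.
by exists 1%N, [:: x]; split=> //=; rewrite ?big_seq1// => y;
  rewrite mem_seq1 mem_cat => /eqP ->; apply/orP; left.
Qed.

Lemma word_lengthP S w : (exists n, word_of_length S w n) ->
  word_of_length S w (word_length S w) /\
  forall n, word_of_length S w n -> (word_length S w <= n)%N.
Proof.
move=> [n nS]; rewrite /word_length; case: pselect => [h|[]]; last first.
  by exists n; exact/asboolP.
case: ex_minnP => m /asboolP mS mmin; split=> // k kS; apply: mmin.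
exact/asboolP.
Qed.

Lemma finite_ball T l : finite_set [set w : G |
  exists2 n, (n <= l)%N & word_of_length T w n].
Proof.
pose L := T ++ [seq x^-1 | x <- T].
elim: l => [|l ih].
  apply: (sub_finite_set _ (finite_set1 (1 : G))) => w /= [n].
  by rewrite leqn0 => /eqP -> [s [/size0nil -> _ <-]]; rewrite big_nil.
apply: (@sub_finite_set _ _ ([set 1] `|` [set x * w | x in [set` L] & w in
    [set w : G | exists2 n, (n <= l)%N & word_of_length T w n]])).
  move=> w /= [n nl [[|x s] [sn sT sw]]].
    by left; rewrite -sw big_nil.
  right; exists x; first by apply: sT; rewrite mem_head.
  exists (\prod_(y <- s) y); last by rewrite -sw big_cons.
  exists (size s); first by rewrite -ltnS (leq_trans _ nl)// -sn.
  by exists s; split=> // y ys; apply: sT; rewrite in_cons ys orbT.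
rewrite finite_setU; split; first exact: finite_set1.
by apply: finite_image2 => //; exact: finite_seq.
Qed.

Lemma distortion_max T H S l :
    finite_generating_set [set: G] T -> finite_generating_set H S ->
  (exists w, [/\ H w, (word_length T w <= l)%N &
                 word_length S w = distortion T H S l]) /\
  (forall w, H w -> (word_length T w <= l)%N ->
             (word_length S w <= distortion T H S l)%N).
Proof.
move=> TG SH; pose E := [set w | H w /\ (word_length T w <= l)%N].
pose D := word_length S @` E.
have E1 : E 1.
  split; first by rewrite -SH => M [[]].
  have w1 : word_of_length T 1 0 by exists [::]; split=> //; rewrite big_nil.
  have [_ /(_ 0%N w1) T1] := @word_lengthP T 1 (ex_intro _ 0%N w1).
  exact: leq_trans T1 _.
have finD : finite_set D.
  apply: finite_image; apply: sub_finite_set (finite_ball T l) => w [Hw wl] /=.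
  exists (word_length T w) => //.
  exact: (word_lengthP (generated_word TG (I : [set: G] w))).1.
have [N ND] : exists N, forall d, D d -> (d <= N)%N.
  have /finite_seqP[s Ds] := finD; exists (\max_(i <- s) i) => d.
  by rewrite Ds => ds; exact: (@leq_bigmax_seq _ s xpredT id d).
have exD : exists d, `[< D d >].
  by exists (word_length S 1); apply/asboolP; exists 1.
have leN d : `[< D d >] -> (d <= N)%N by move=> /asboolP/ND.
have [M DM DMmax] := ex_maxnP exD leN.
move/asboolP: DM => DM.
have -> : distortion T H S l = M.
  have supM : supremums D M.
    split; first by move=> d Dd; apply: DMmax; exact/asboolP.
    by move=> d; apply.
  rewrite /distortion -/E -/D /supremum ifF; last first.
    by apply/negP => /eqP D0; rewrite D0 in DM.
  by apply: (is_subset1_supremums _ supM); exact: xgetI supM.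
split.
  by have [w [Hw wl] wM] := DM; exists w.
by move=> w Hw wl; apply: DMmax; apply/asboolP; exists w.
Qed.

End DistortionMax.

(* Main.v *)
Require Import Defs.
From HB Require Import structures.
From mathcomp Require Import all_boot all_order all_algebra.
From mathcomp Require Import boolp classical_sets functions cardinality fsbigop.
From mathcomp Require Import zify.

(* Suppose that Z wr Z does not embed in G, and write D = G'. For a in D and
   g in G the conjugates a ^ (g ^ i) are then linearly dependent over Z (else a
   and g generate Z wr Z), and since G acts on D through the finitely generated
   abelian group G/D, it follows that D has finite rank. If some g had infinite
   order modulo phi(G), the subnormal chain G > phi(G) > phi^2(G) > ... would
   have infinitely many non-torsion factors, which the finite ranks of D and
   G/D forbid. So G/phi(G) is a finitely generated metabelian torsion group,
   hence finite, and an infinite subgroup of finite index is undistorted. *)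

Set Implicit Arguments.
Unset Strict Implicit.
Unset Printing Implicit Defensive.

Local Open Scope classical_set_scope.
Local Open Scope group_scope.

(** * Isolated subgroups of abelian groups *)

Section IsolatedSubgroups.
Import GRing.Theory.
Local Open Scope ring_scope.
Variable V : zmodType.
Implicit Types (W : set V) (B : seq V) (u v x y : V).

Definition zsubgroup W : Prop := W 0 /\ forall u v, W u -> W v -> W (u - v).

Definition isolated W : Prop :=
  zsubgroup W /\ forall v (k : int), k != 0 -> W (v *~ k) -> W v.

(** The elements with a nonzero multiple in the subgroup generated by [B]. When a finite [B] gives
    the whole group, the group has finite rational rank. *)
Definition isolated_span B : set V := smallest isolated [set` B].

Lemma zsubgroupB W u v : zsubgroup W -> W u -> W v -> W (u - v).
Proof. by move=> [_]; exact. Qed.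

Lemma zsubgroupN W v : zsubgroup W -> W v -> W (- v).
Proof. by move=> [W0 WB] Wv; rewrite -sub0r; exact: WB. Qed.

Lemma zsubgroupD W u v : zsubgroup W -> W u -> W v -> W (u + v).
Proof.
by move=> Wsub Wu Wv; rewrite -[v]opprK; apply: Wsub.2 => //; exact: zsubgroupN.
Qed.

Lemma zsubgroupMn W v n : zsubgroup W -> W v -> W (v *+ n).
Proof.
move=> Wsub Wv; elim: n => [|n ih]; first by rewrite mulr0n; exact: Wsub.1.
by rewrite mulrS; exact: zsubgroupD.
Qed.

Lemma zsubgroupMz W v k : zsubgroup W -> W v -> W (v *~ k).
Proof.
move=> Wsub Wv; case: k => n; first exact: zsubgroupMn.
by rewrite NegzE mulrNz; apply: zsubgroupN => //; exact: zsubgroupMn.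
Qed.

Lemma zsubgroup_absz W v (k : int) : zsubgroup W -> W (v *~ k) -> W (v *+ `|k|%N).
Proof.
move=> Wsub; case: k => n //= /(zsubgroupN Wsub).
by rewrite NegzE mulrNz opprK.
Qed.

Lemma zsubgroup_sum W (I : eqType) (r : seq I) (F : I -> V) :
  zsubgroup W -> (forall i, i \in r -> W (F i)) -> W (\sum_(i <- r) F i).
Proof.
move=> Wsub WF; rewrite big_seq_cond; apply: (big_ind W) => //.
- exact: Wsub.1.
- by move=> *; exact: zsubgroupD.
- by move=> i /andP[ir _]; exact: WF.
Qed.

Lemma isolated_spanP B : isolated (isolated_span B).
Proof.
split; first split.
- by move=> W [[[]]].
- by move=> u v Bu Bv W WB; apply: WB.1.1.2; [exact: (Bu W)|exact: (Bv W)].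
- by move=> v k k0 Bv W WB; apply: (WB.1.2 _ _ k0); exact: (Bv W).
Qed.

Lemma isolated_span_min B W :
  isolated W -> (forall b, b \in B -> W b) -> isolated_span B `<=` W.
Proof. by move=> WI WB; apply: smallest_sub => // b; exact: WB. Qed.

Lemma isolated_span_gen B b : b \in B -> isolated_span B b.
Proof. by move=> bB; exact: (@sub_gen_smallest _ isolated [set` B]). Qed.

(** Solving for one coordinate: the elements with this property form an isolated subgroup containing
    [b :: B]. For a difference, the two relations are multiplied crosswise. *)
Lemma isolated_span_cons B b v : isolated_span (b :: B) v ->
  exists2 k : int, k != 0 & exists e, isolated_span B (v *~ k + b *~ e).
Proof.
have [Bsub Biso] := isolated_spanP B.
apply: (@isolated_span_min (b :: B)
  [set w | exists2 k : int, k != 0 &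
     exists e, isolated_span B (w *~ k + b *~ e)]).
  split=> [|w n n0 [k k0 [e wB]]]; last first.
    by exists (n * k); [rewrite mulf_neq0|exists e; rewrite mulrzA].
  split=> [|u w [k k0 [e uB]] [l l0 [f wB]]].
    by exists 1 => //; exists 0; rewrite mulr0z mulr1z addr0; exact: Bsub.1.
  exists (k * l); first by rewrite mulf_neq0.
  exists (e * l - f * k).
  have -> : (u - w) *~ (k * l) + b *~ (e * l - f * k) =
      (u *~ k + b *~ e) *~ l - (w *~ l + b *~ f) *~ k.
    rewrite !mulrzDl mulNrz -!mulrzA mulrzDr mulrNz (mulrC l k) opprD.
    by rewrite !addrA; congr (_ - _); rewrite -!addrA; congr (_ + _); exact: addrC.
  by apply: (zsubgroupB Bsub); apply: (zsubgroupMz _ Bsub).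
move=> w; rewrite in_cons => /predU1P[->|wB].
  by exists 1 => //; exists (-1); rewrite -mulrzDr subrr; exact: Bsub.1.
exists 1 => //; exists 0; rewrite mulr0z mulr1z addr0.
exact: isolated_span_gen.
Qed.

Lemma isolated_span_nil v :
  isolated_span [::] v -> exists2 k : int, k != 0 & v *~ k = 0.
Proof.
apply: (@isolated_span_min [::]
  [set w | exists2 k : int, k != 0 & w *~ k = 0]) => //.
split=> [|w n n0 [k k0 wB]]; last first.
  by exists (n * k); [rewrite mulf_neq0|rewrite mulrzA].
split=> [|u w [k k0 uB] [l l0 wB]]; first by exists 1.
exists (k * l); first by rewrite mulf_neq0.
by rewrite mulrzDl mulNrz mulrzA uB mul0rz mulrC mulrzA wB mul0rz subrr.
Qed.

(* Eliminate the first element [b] of [B]: a multiple of any [x] in [L i] is,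
   up to a multiple of some [y] deep in the chain, in the span of the rest. *)
Lemma isolated_span_chain B (L : nat -> set V) :
    (forall i, zsubgroup (L i)) ->
    (forall i j, (i <= j)%N -> L j `<=` L i) ->
  ~ forall i, exists j x, [/\ L i x, isolated_span B x &
                             forall k : int, k != 0 -> ~ L j (x *~ k)].
Proof.
move=> Lsub Lanti; elim: B => [|b B ih] Ldesc.
  have [j [x [_ /isolated_span_nil[k k0 xk0] /(_ k k0)]]] := Ldesc 0%N.
  by apply; rewrite xk0; exact: (Lsub j).1.
have [Bsub Biso] := isolated_spanP B.
(* Either the descent already takes place inside the span of [B], or it fails at some [i0]; then
   witnesses taken from level [i0] or deeper avoid that span. *)
apply: ih; have [//|/existsNP[i0 ndesc] i] := pselect (forall i, exists j x,
  [/\ L i x, isolated_span B x & forall k : int, k != 0 -> ~ L j (x *~ k)]).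
have notB j x : L i0 x -> (forall k : int, k != 0 -> ~ L j (x *~ k)) ->
    ~ isolated_span B x.
  by move=> Lx xL Bx; apply: ndesc; exists j, x.
have [j [x [Lx /isolated_span_cons[k k0 [e xB]] xL]]] := Ldesc (maxn i0 i).
have [j' [y [Ly /isolated_span_cons[l l0 [f yB]] yL]]] := Ldesc (maxn i0 (maxn i j)).
(* With [f = 0] a nonzero multiple of [y], hence [y] itself, would lie in the span of [B]. *)
have f0 : f != 0.
  apply/eqP => f0; apply: (notB j' y _ yL).
    by apply: Lanti Ly; rewrite leq_maxl.
  by apply: (Biso _ l) => //; rewrite f0 mulr0z addr0 in yB.
(* The combination in which [b] cancels. Since [y] was chosen inside [L j], a multiple of it by [m]
   in [L j] would put [x *~ (k * f * m)] there too. *)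
exists j, (x *~ (k * f) - y *~ (l * e)); split.
- apply: (zsubgroupB (Lsub i)); apply: (zsubgroupMz _ (Lsub i)).
    by apply: Lanti Lx; rewrite leq_maxr.
  by apply: Lanti Ly; rewrite !leq_max leqnn !orbT.
- have -> : x *~ (k * f) - y *~ (l * e) =
      (x *~ k + b *~ e) *~ f - (y *~ l + b *~ f) *~ e.
    rewrite !mulrzDl -!mulrzA (mulrC f e) opprD addrACA -!addrA.
    by rewrite subrr addr0.
  by apply: (zsubgroupB Bsub); apply: (zsubgroupMz _ Bsub).
- move=> m m0 Lz; apply: (xL (k * f * m)); first by rewrite !mulf_neq0.
  rewrite mulrzA -[x *~ (k * f)](subrK (y *~ (l * e))) mulrzDl.
  apply: (zsubgroupD (Lsub j)) => //; rewrite -mulrzA.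
  apply: (zsubgroupMz _ (Lsub j)).
  by apply: Lanti Ly; rewrite !leq_max leqnn !orbT.
Qed.

End IsolatedSubgroups.

(** * The derived subgroup as a module, and the abelianization *)

Section SubgroupTheory.
Variable G : groupType.
Implicit Types (H N A : set G) (S T : seq G) (x y z : G).

Lemma subgroupV H x : subgroup H -> H x -> H x^-1.
Proof. by move=> [H1 HF] Hx; rewrite -div1g; exact: HF. Qed.

Lemma subgroupM H x y : subgroup H -> H x -> H y -> H (x * y).
Proof.
by move=> Hsub Hx Hy; rewrite -[y]invgK; apply: Hsub.2 => //; exact: subgroupV.
Qed.

Lemma subgroupX H x n : subgroup H -> H x -> H (x ^+ n).
Proof.
move=> Hsub Hx; elim: n => [|n ih]; first by rewrite expg0; exact: Hsub.1.
by rewrite expgS; exact: subgroupM.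
Qed.

Lemma subgroup_prod H (I : eqType) (r : seq I) (F : I -> G) :
  subgroup H -> (forall i, i \in r -> H (F i)) -> H (\prod_(i <- r) F i).
Proof.
move=> Hsub HF; rewrite big_seq_cond; apply: (big_ind H) => //.
- exact: Hsub.1.
- by move=> *; exact: subgroupM.
- by move=> i /andP[ir _]; exact: HF.
Qed.

Lemma generated_subgroup A : subgroup (generated A).
Proof.
split=> [W [[]]//|x y Ax Ay W WA].
by apply: WA.1.2; [exact: (Ax W)|exact: (Ay W)].
Qed.

Lemma generated_gen A : A `<=` generated A.
Proof. exact: sub_gen_smallest. Qed.

Lemma generated_min A H : subgroup H -> A `<=` H -> generated A `<=` H.
Proof. by move=> Hsub; exact: smallest_sub. Qed.

Lemma commg_mull x y z : [~ x * y, z] = [~ x, z] ^ y * [~ y, z].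
Proof. by rewrite /commg /conjg !gnorm. Qed.

Lemma commg_invl x z : [~ x^-1, z] = [~ x, z]^-1 ^ x^-1.
Proof. by rewrite /commg /conjg !gnorm. Qed.

Lemma subgroup_commg N z : normal_subgroup N -> subgroup [set x | N [~ x, z]].
Proof.
move=> [Nsub NJ]; split=> [|x y /= Nx Ny]; first by rewrite /= comm1g; exact: Nsub.1.
rewrite commg_mull commg_invl; apply: subgroupM => //; first exact: NJ.
by apply: NJ; exact: subgroupV.
Qed.

(** Commutators are multiplicative up to conjugation, so the elements whose commutator with a fixed
    one lies in [N] form a subgroup. This is used in the first slot and then, inverting commutators,
    in the second. *)
Lemma generated_commg N T : normal_subgroup N ->
    finite_generating_set [set: G] T ->
    (forall s t, s \in T -> t \in T -> N [~ s, t]) ->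
  forall x y, N [~ x, y].
Proof.
move=> Nnorm TG NT x y.
have NxT t : t \in T -> N [~ x, t].
  move=> tT; have : [set: G] x by [].
  rewrite -TG; move: x; apply: (generated_min (subgroup_commg t Nnorm)).
  by move=> s sT; exact: NT.
have : [set: G] y by [].
rewrite -TG; move: y.
have sub : subgroup [set y | N [~ x, y]].
  have -> : [set y | N [~ x, y]] = [set y | N [~ y, x]].
    by apply/seteqP; split=> y /= Ny; rewrite -invgR; apply: (subgroupV Nnorm.1).
  exact: subgroup_commg.
by apply: (generated_min sub).
Qed.

Lemma derived_commg x y : derived_subgroup G [~ x, y].
Proof. by apply: generated_gen; exists x => //; exists y. Qed.

Lemma derived_normal : normal_subgroup (derived_subgroup G).
Proof.
have Dsub := generated_subgroup [set [~ x, y] | x in [set: G] & y in [set: G]].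
split=> // x y Dx; rewrite -(mulVKg x (x ^ y)) -commgEl.
by apply: (subgroupM Dsub) => //; exact: derived_commg.
Qed.

End SubgroupTheory.

Section DerivedModule.
Variable G : groupType.

(** The proof that [G] is metabelian is a parameter so that the additive structure, whose
    commutativity rests on it, can be attached to the type. *)
Definition derived_module of metabelian G : Type :=
  {x : G | `[< derived_subgroup G x >]}.

Variable mG : metabelian G.
Local Notation D := (derived_subgroup G).
Local Notation V := (derived_module mG).

HB.instance Definition _ := SubChoice.copy V {x : G | `[< D x >]}.

Definition derived_mk (x : G) (Dx : D x) : V := exist _ x (asboolT Dx).

Lemma derived_val (v : V) : D (val v).
Proof. by apply/asboolP; exact: (svalP v). Qed.

Let Dsub : subgroup D := (derived_normal G).1.

Definition derived_add (u v : V) : V :=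
  derived_mk (subgroupM Dsub (derived_val u) (derived_val v)).

Definition derived_opp (v : V) : V :=
  derived_mk (subgroupV Dsub (derived_val v)).

Lemma derived_addA : associative derived_add.
Proof. by move=> u v w; apply: val_inj; exact: mulgA. Qed.

Lemma derived_addC : commutative derived_add.
Proof. by move=> u v; apply: val_inj; exact: mG (derived_val u) (derived_val v). Qed.

Lemma derived_add0 : left_id (derived_mk Dsub.1) derived_add.
Proof. by move=> u; apply: val_inj; exact: mul1g. Qed.

Lemma derived_addN : left_inverse (derived_mk Dsub.1) derived_opp derived_add.
Proof. by move=> u; apply: val_inj; exact: mulVg. Qed.

HB.instance Definition _ := GRing.isZmodule.Build V
  derived_addA derived_addC derived_add0 derived_addN.

Implicit Types (u v : V) (g h : G).

Lemma derived_valD u v : val (u + v)%R = val u * val v. Proof. by []. Qed.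

Lemma derived_valMn v n : val (v *+ n)%R = val v ^+ n.
Proof.
elim: n => [|n ih]; first by rewrite GRing.mulr0n.
by rewrite GRing.mulrS expgS derived_valD ih.
Qed.

Definition derived_act g v : V :=
  derived_mk ((derived_normal G).2 (val v) g (derived_val v)).

Lemma derived_val_act g v : val (derived_act g v) = val v ^ g.
Proof. by []. Qed.

Lemma derived_act_is_zmod_morphism g : GRing.zmod_morphism (derived_act g).
Proof.
by move=> u v; apply: val_inj; rewrite /= conjMg conjVg.
Qed.

HB.instance Definition _ g :=
  GRing.isZmodMorphism.Build V V (derived_act g) (derived_act_is_zmod_morphism g).

Lemma derived_actM g h v :
  derived_act (g * h) v = derived_act h (derived_act g v).
Proof. by apply: val_inj; rewrite /= conjgM. Qed.

Lemma derived_act1 v : derived_act 1 v = v.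
Proof. by apply: val_inj; rewrite /= conjg1. Qed.

Lemma derived_actK g : cancel (derived_act g) (derived_act g^-1).
Proof. by move=> v; rewrite -derived_actM mulgV derived_act1. Qed.

Lemma derived_act_id g v : D g -> derived_act g v = v.
Proof.
move=> Dg; apply: val_inj; rewrite derived_val_act conjgE.
by rewrite (mG (derived_val v) Dg) mulKg.
Qed.

(** [g * h] and [h * g] differ by a commutator, which acts trivially because G' is abelian: the
    action factors through G/G'. *)
Lemma derived_actC g h v :
  derived_act g (derived_act h v) = derived_act h (derived_act g v).
Proof.
rewrite -!derived_actM commgC [RHS]derived_actM derived_actM.
by rewrite [LHS]derived_act_id ?derived_actM//; exact: derived_commg.
Qed.

End DerivedModule.

Section Abelianization.
Variable G : groupType.
Local Notation D := (derived_subgroup G).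
Implicit Types x y z : G.

Definition abel_rel x y : bool := `[< D (x / y) >].

Let Dsub : subgroup D := (derived_normal G).1.
Let DJ := (derived_normal G).2.

Lemma abel_rel_refl : reflexive abel_rel.
Proof. by move=> x; apply/asboolP; rewrite divgg; exact: Dsub.1. Qed.

Lemma abel_rel_sym : symmetric abel_rel.
Proof.
by move=> x y; apply/asboolP/asboolP => Dxy; rewrite -invgF; exact: (subgroupV Dsub).
Qed.

Lemma abel_rel_trans : transitive abel_rel.
Proof.
move=> y x z /asboolP Dxy /asboolP Dyz; apply/asboolP.
by rewrite -(divgKA y x z^-1); exact: (subgroupM Dsub).
Qed.

Canonical abel_equiv :=
  EquivRel abel_rel abel_rel_refl abel_rel_sym abel_rel_trans.

(** G/G' as a quotient type, so that it can carry an additive structure to which isolated spans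
    apply. *)
Definition abelianization : Type := {eq_quot abel_equiv}%qT.

HB.instance Definition _ := Choice.on abelianization.

Definition abel (x : G) : abelianization := (\pi_({eq_quot abel_equiv}) x)%qT.

Lemma abel_eq x y : abel x = abel y <-> D (x / y).
Proof. by split=> [/eqmodP/asboolP//|Dxy]; apply/eqmodP/asboolP. Qed.

Definition abel_repr (q : abelianization) : G :=
  repr (q : {eq_quot abel_equiv}%qT).

Lemma abel_reprK : cancel abel_repr abel.
Proof. by move=> q; rewrite /abel /abel_repr reprK. Qed.

Lemma abel_comm x y : abel (x * y) = abel (y * x).
Proof.
apply/abel_eq; have -> : x * y / (y * x) = [~ x^-1, y^-1].
  by rewrite /commg /conjg !gnorm.
exact: derived_commg.
Qed.

Lemma abel_congr x x' y y' :
  abel x = abel x' -> abel y = abel y' -> abel (x * y) = abel (x' * y').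
Proof.
move=> /abel_eq Dx /abel_eq Dy; apply/abel_eq.
have -> : x * y / (x' * y') = (y / y') ^ x^-1 * (x / x').
  by rewrite /conjg !gnorm.
by apply: (subgroupM Dsub) => //; exact: DJ.
Qed.

Definition abel_add (p q : abelianization) := abel (abel_repr p * abel_repr q).

Lemma abel_addE x y : abel_add (abel x) (abel y) = abel (x * y).
Proof. by apply: abel_congr; rewrite abel_reprK. Qed.

Definition abel_opp (p : abelianization) := abel (abel_repr p)^-1.

Lemma abel_addA : associative abel_add.
Proof.
move=> p q r; rewrite -[p]abel_reprK -[q]abel_reprK -[r]abel_reprK.
by rewrite !abel_addE mulgA.
Qed.

Lemma abel_addC : commutative abel_add.
Proof. by move=> p q; exact: abel_comm. Qed.

Lemma abel_add0 : left_id (abel 1) abel_add.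
Proof. by move=> p; rewrite -[p]abel_reprK abel_addE mul1g. Qed.

Lemma abel_addN : left_inverse (abel 1) abel_opp abel_add.
Proof. by move=> p; rewrite -[X in abel_add _ X]abel_reprK abel_addE mulVg. Qed.

HB.instance Definition _ := GRing.isZmodule.Build abelianization
  abel_addA abel_addC abel_add0 abel_addN.

Lemma abelM x y : abel (x * y) = (abel x + abel y)%R.
Proof. by symmetry; exact: abel_addE. Qed.

Lemma abelV x : abel x^-1 = (- abel x)%R.
Proof.
by apply/eqP; rewrite -GRing.addr_eq0 -abelM mulVg.
Qed.

Lemma abelX x n : abel (x ^+ n) = (abel x *+ n)%R.
Proof.
elim: n => [|n ih]; first by rewrite GRing.mulr0n.
by rewrite expgS abelM ih GRing.mulrS.
Qed.

End Abelianization.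

(** * Embedding the wreath product *)

Section IntegerPowers.
Variables (G : groupType) (g : G).

Definition expgz (k : int) : G :=
  match k with Posz n => g ^+ n | Negz n => g ^- n.+1 end.

Lemma expgzS k : expgz (k + 1)%R = expgz k * g.
Proof.
case: k => n.
  by have -> : (Posz n + 1)%R = Posz n.+1 by [rewrite -addn1]; rewrite /= expgSr.
case: n => [|n]; first by rewrite (_ : (Negz 0 + 1)%R = 0%R)//= mulVg.
have -> : (Negz n.+1 + 1)%R = Negz n.
  by rewrite !NegzE -addn1 PoszD GRing.opprD GRing.addrNK.
by rewrite /= [in RHS]expgS invgM mulgVK.
Qed.

Lemma expgzD k l : expgz (k + l)%R = expgz k * expgz l.
Proof.
elim: l => [|n ih|n ih]; first by rewrite GRing.addr0 mulg1.
  by rewrite -addn1 PoszD GRing.addrA !expgzS ih mulgA.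
apply: (@mulIg _ g); rewrite -mulgA -!expgzS -GRing.addrA.
by rewrite -addn1 PoszD GRing.opprD GRing.addrNK.
Qed.

Lemma expgzN k : expgz (- k)%R = (expgz k)^-1.
Proof. by apply/eqP; rewrite -mulg_eq1 -expgzD GRing.addNr. Qed.

End IntegerPowers.

Arguments expgz : simpl never.

Section WreathEmbedding.
Import GRing.Theory.
Variables (G : groupType) (mG : metabelian G).
Local Notation V := (derived_module mG).
Variables (a : V) (g : G).

(** [a] generates a free module over the polynomial ring Z[t], with t acting as conjugation by [g].
    Nonnegative powers suffice, since conjugating by a power of [g] brings any finite relation into
    this form. *)
Definition orbit_free : Prop := forall n (c : nat -> int),
  (\sum_(i < n) derived_act (g ^+ i) a *~ c i = 0)%R ->
  forall i, (i < n)%N -> c i = 0%R.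

(** The image of a lamp configuration. The sign in [- x] reconciles the left shift of the wreath
    product with conjugation, which acts on the right. *)
Definition lamp_sum (f : int -> int) : V :=
  (\sum_(x \in [set: int]) derived_act (expgz g (- x)) a *~ f x)%R.

Lemma lamp_sumE (f : int -> int) (r : seq int) : uniq r ->
    (forall x, x \notin r -> f x = 0%R) ->
  lamp_sum f = (\sum_(x <- r) derived_act (expgz g (- x)) a *~ f x)%R.
Proof.
move=> runiq fr; rewrite /lamp_sum -set_true -(@bigfs _ _ _ _ r)// => x _ xr.
by rewrite fr// mulr0z.
Qed.

Lemma lamp_support (f : int -> int) : finite_set [set x | f x <> 0%R] ->
  exists2 r : seq int, uniq r & forall x, x \notin r -> f x = 0%R.
Proof.
move=> /finite_seqP[r fr]; exists (undup r) => [|x]; first exact: undup_uniq.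
rewrite mem_undup => xr; have [//|fx] := pselect (f x = 0%R).
by have : [set` r] x by [rewrite -fr]; rewrite /= (negbTE xr).
Qed.

Lemma lamp_sumD (f f' : int -> int) : finite_set [set x | f x <> 0%R] ->
    finite_set [set x | f' x <> 0%R] ->
  lamp_sum (fun x => f x + f' x)%R = (lamp_sum f + lamp_sum f')%R.
Proof.
move=> /lamp_support[r _ fr] /lamp_support[r' _ fr'].
pose s := undup (r ++ r').
have fs x : x \notin s -> f x = 0%R /\ f' x = 0%R.
  by rewrite mem_undup mem_cat negb_or => /andP[xr xr']; rewrite fr// fr'.
rewrite !(@lamp_sumE _ s) ?undup_uniq//.
- by rewrite -big_split/=; apply: eq_bigr => x _; rewrite mulrzDr.
- by move=> x /fs[].
- by move=> x /fs[].
- by move=> x /fs[-> ->].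
Qed.

Lemma lamp_sum_shift (f : int -> int) b : finite_set [set x | f x <> 0%R] ->
  lamp_sum (fun x => f (- b + x)%R) = derived_act (expgz g (- b)) (lamp_sum f).
Proof.
move=> /lamp_support[r runiq fr].
rewrite (lamp_sumE runiq fr) (@lamp_sumE _ [seq (b + x)%R | x <- r]); first last.
- move=> x xr; apply: fr; apply: contra xr => xr.
  by apply/mapP; exists (- b + x)%R => //; rewrite addrA subrr add0r.
- by rewrite map_inj_uniq//; exact: addrI.
rewrite big_map raddf_sum/=; apply: eq_bigr => x _.
by rewrite raddfMz/= -derived_actM -expgzD addrA addNr add0r opprD addrC.
Qed.

Lemma lamp_sum_eq0 (f : int -> int) : orbit_free ->
    finite_set [set x | f x <> 0%R] -> lamp_sum f = 0%R ->
  forall x, f x = 0%R.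
Proof.
move=> free /lamp_support[r runiq fr] f0 x.
pose N := (\max_(x <- r) `|x|%N)%N.
have leN y : y \in r -> (`|y| <= N)%N.
  by move=> yr; exact: (@leq_bigmax_seq _ r xpredT absz y).
have [xr|/fr//] := boolP (x \in r).
(* The support lies in [-N, N]. Writing [x = N - i] and conjugating by the [N]-th power of [g] turns
   the exponent [- x] into [i], between 0 and 2N. *)
pose h (i : nat) : int := (Posz N - Posz i)%R.
have hinj : injective h by move=> i j /addrI/oppr_inj[].
have hr y : (`|y| <= N)%N -> exists2 i, (i < (2 * N).+1)%N & y = h i.
  move=> yN; exists `|Posz N - y|%N; first by lia.
  by rewrite /h; lia.
move: f0; rewrite (@lamp_sumE _ [seq h i | i <- iota 0 (2 * N).+1]); first last.
- move=> y yh; apply: fr; apply: contra yh => /leN/hr[i iN ->].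
  by apply: map_f; rewrite mem_iota add0n iN.
- by rewrite map_inj_uniq// iota_uniq.
rewrite big_map -[iota _ _]/(index_iota 0 (2 * N).+1) big_mkord.
move=> /(congr1 (derived_act (expgz g (Posz N)))); rewrite raddf0 raddf_sum => sum0.
have [i iN ->] := hr _ (leN _ xr); apply: (free (2 * N).+1 (f \o h)) => //.
rewrite -[RHS]sum0; apply: eq_bigr => j _; rewrite raddfMz/= -derived_actM -expgzD.
by rewrite /h opprB subrK.
Qed.

(** A power [g ^+ n] in G' would fix [a], which is a relation with coefficients 1 at [n] and -1 at
    0. *)
Lemma orbit_free_order : orbit_free ->
  forall n, (0 < n)%N -> ~ derived_subgroup G (g ^+ n).
Proof.
move=> free n n0 Dgn.
pose c i : int := ((i == n)%:R - (i == 0)%:R)%R.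
have := free n.+1 c; rewrite big_ord_recr/= derived_act_id//.
case: n n0 @c Dgn => // n _ c Dgn; rewrite big_ord_recl/= derived_act1.
rewrite big1 => [|i _]; last first.
  by rewrite /c /bump/= add1n !eqSS ltn_eqF// subrr mulr0z.
rewrite addr0 -mulrzDr (_ : (c 0%N + c n.+1)%R = 0%R); last by rewrite /c eqxx.
rewrite mulr0z.
by move=> /(_ erefl 0%N isT).
Qed.

Definition wreath_map (u : ZwrZ) : G :=
  val (lamp_sum (wreath_fun u)) * expgz g (wreath_pos u).

Lemma wreath_mapM : {morph wreath_map : u v / u * v}.
Proof.
move=> u v; rewrite /wreath_map.
have -> : wreath_pos (u * v) = (wreath_pos u + wreath_pos v)%R by [].
have -> : lamp_sum (wreath_fun (u * v)) = (lamp_sum (wreath_fun u) +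
    derived_act (expgz g (- wreath_pos u)) (lamp_sum (wreath_fun v)))%R.
  rewrite -lamp_sum_shift; last exact: (wreath_finsupp v).
  rewrite -lamp_sumD//; first exact: (wreath_finsupp u).
  apply: sub_finite_set (finite_image (fun x : int => (wreath_pos u + x)%R)
    (wreath_finsupp v)) => x /= vx.
  by exists (- (wreath_pos u : int) + x)%R => //; rewrite addrA subrr add0r.
rewrite derived_valD derived_val_act expgzN expgzD /conjg invgK.
by rewrite !mulgA mulgVK.
Qed.

HB.instance Definition _ := isMultiplicative.Build ZwrZ G wreath_map wreath_mapM.

(** A kernel element has position 0, as otherwise a positive power of [g] would lie in G'; then
    freeness makes all its lamps vanish. *)
Lemma wreath_map_inj : orbit_free -> injective wreath_map.
Proof.
move=> free.
have ker u : wreath_map u = 1 -> u = 1.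
  move=> u1; have pos0 : wreath_pos u = (0%R : int).
    apply/eqP/negP => /negP b0.
    apply: (orbit_free_order free (n := `|wreath_pos u : int|)).
      by rewrite absz_gt0.
    have : derived_subgroup G (expgz g (wreath_pos u)).
      rewrite -(mulKg (val (lamp_sum (wreath_fun u))) (expgz _ _)).
      rewrite -/(wreath_map u) u1 mulg1; apply: (subgroupV (derived_normal G).1).
      exact: derived_val.
    case: (wreath_pos u : int) => n //= /(subgroupV (derived_normal G).1).
    by rewrite invgK.
  apply: wreath_eq => [x|]; last exact: pos0.
  apply: (lamp_sum_eq0 free (wreath_finsupp u)); apply: val_inj.
  by move: u1; rewrite /wreath_map pos0 /= mulg1.
move=> u v uv; apply: divg1_eq; apply: ker.
rewrite wreath_mapM; apply: (@mulIg _ (wreath_map v)).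
by rewrite -mulgA -wreath_mapM mulVg -uv mul1g -wreath_mapM mulg1.
Qed.

Lemma orbit_free_wreath : orbit_free ->
  exists H : set G, subgroup H /\ isomorphic_to_subgroup ZwrZ H.
Proof.
move=> free; exists (range wreath_map); split; last first.
  by exists wreath_map; split => //; exact: wreath_map_inj.
split=> [|_ _ [u _ <-] [v _ <-]].
  exists 1 => //; apply: (@mulIg _ (wreath_map 1)).
  by rewrite -wreath_mapM mulg1 mul1g.
exists (u / v) => //; apply: (@mulIg _ (wreath_map v)).
by rewrite mulgVK -wreath_mapM mulgVK.
Qed.

End WreathEmbedding.

(** * Finite rank of the derived subgroup *)

Section FiniteRank.
Import GRing.Theory.
Variables (G : groupType) (mG : metabelian G).
Local Notation V := (derived_module mG).
Local Notation act := (@derived_act _ mG).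
Implicit Types (a b v : V) (g t : G) (W : set V).

(** Vanishing coefficients at the top are dropped; those at the bottom are removed by undoing one
    conjugation by [g]. The case [n = 0] says that [a] is torsion. *)
Lemma not_orbit_free a g : ~ orbit_free a g ->
  exists n (c : nat -> int), [/\ c 0%N != 0%R, c n != 0%R &
    (\sum_(i < n.+1) act (g ^+ i) a *~ c i = 0)%R].
Proof.
move=> /existsNP[n /existsNP[c /not_implyP[sum0 /existsNP[i]]]].
move=> /not_implyP[iltn /eqP ci].
elim: n c sum0 i iltn ci => // n ih c sum0 i iltn ci.
have [cn0|cn] := eqVneq (c n) 0%R.
  apply: (ih c _ i) => //.
    by rewrite big_ord_recr/= cn0 mulr0z addr0 in sum0.
  by rewrite ltn_neqAle -ltnS iltn andbT; apply: contra_eq_neq cn0 => <-.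
have [c00|c0] := eqVneq (c 0%N) 0%R; last by exists n, c.
case: i iltn ci => [|i] iltn ci; first by rewrite c00 eqxx in ci.
apply: (ih (c \o S) _ i) => //; apply: (can_inj (derived_actK g)).
rewrite raddf0 raddf_sum -[RHS]sum0 big_ord_recl/= c00 mulr0z add0r.
by apply: eq_bigr => j _; rewrite raddfMz/= -derived_actM -expgSr.
Qed.

Lemma isolated_preim_act g W : isolated W -> isolated (act g @^-1` W).
Proof.
move=> [Wsub Wiso]; split=> [|v k k0 /=]; last by rewrite raddfMz/=; exact: Wiso.
split=> [|u v /= Wu Wv]; first by rewrite /= raddf0; exact: Wsub.1.
by rewrite raddfB; exact: (zsubgroupB Wsub).
Qed.

(* A relation between the [a ^ (g ^ i)], [i <= n], whose two extreme
   coefficients are nonzero expresses multiples of [a ^ (g ^ n)] and of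
   [a ^ (g ^ -1)] through their neighbours. *)
Lemma act_orbit_bound a g : ~ orbit_free a g -> exists n, forall W,
    isolated W -> (forall i, (i < n)%N -> W (act (g ^+ i) a)) ->
  (forall i, W (act (g ^+ i) a)) /\ W (act g^-1 a).
Proof.
move=> /not_orbit_free[n [c [c0 cn sum0]]]; exists n => W [Wsub Wiso] Wn.
have Wall i : W (act (g ^+ i) a).
  elim/ltn_ind: i => i ih; have [/Wn//|ni] := ltnP i n.
  apply: (Wiso _ (c n)) => //; have := congr1 (act (g ^+ (i - n))) sum0.
  rewrite raddf0 big_ord_recr/= raddfD/= raddfMz/= -derived_actM -expgnDr subnKC//.
  move=> /eqP; rewrite addrC addr_eq0 => /eqP ->; apply: (zsubgroupN Wsub).
  rewrite raddf_sum; apply: (zsubgroup_sum Wsub) => j _.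
  rewrite raddfMz/= -derived_actM -expgnDr; apply: (zsubgroupMz _ Wsub).
  by apply: ih; have := ltn_ord j; lia.
split=> //; apply: (Wiso _ (c 0%N)) => //; have := congr1 (act g^-1) sum0.
rewrite raddf0 big_ord_recl/= raddfD/= raddfMz/= derived_act1.
move=> /eqP; rewrite addr_eq0 => /eqP ->; apply: (zsubgroupN Wsub).
rewrite raddf_sum; apply: (zsubgroup_sum Wsub) => j _.
rewrite raddfMz/= -derived_actM; apply: (zsubgroupMz _ Wsub).
by rewrite /bump/= add1n expgSr mulgK.
Qed.

Hypothesis no_free : forall a g, ~ orbit_free a g.

(** Generators are treated one at a time: [B] is replaced by finite segments of the orbits of its
    elements under [t]. Closure under the earlier generators survives because their actions commute
    with that of [t]. *)
Lemma isolated_span_act_closed (B0 : seq V) (T : seq G) : exists B,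
  (forall b, b \in B0 -> isolated_span B b) /\
  forall t, t \in T -> forall v, isolated_span B v ->
    isolated_span B (act t v) /\ isolated_span B (act t^-1 v).
Proof.
elim: T => [|t T [B [B0B Bclosed]]].
  by exists B0; split=> // b; exact: isolated_span_gen.
have [n nP] := choice (fun a => act_orbit_bound (@no_free a t)).
pose B' := [seq act (t ^+ i) b | b <- B, i <- iota 0 (n b)].
have B'iso := isolated_spanP B'.
have B'orbit b : b \in B -> (forall i, isolated_span B' (act (t ^+ i) b)) /\
    isolated_span B' (act t^-1 b).
  move=> bB; apply: nP => // i ilt; apply: isolated_span_gen.
  by apply: allpairs_f_dep => //; rewrite mem_iota.
have B'B i v : isolated_span B v -> isolated_span B' (act (t ^+ i) v).
  move: v; apply: isolated_span_min; first exact: isolated_preim_act.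
  by move=> b bB; exact: (B'orbit b bB).1.
exists B'; split=> [b /B0B|s].
  by rewrite -[b in X in _ -> X]derived_act1 -(expg0 t); exact: B'B.
rewrite in_cons => /predU1P[->{s}|sT] v B'v.
- split; move: v B'v; apply: isolated_span_min;
    try exact: isolated_preim_act; move=> _ /allpairsPdep[b [i [bB _ ->]]] /=.
    by rewrite -derived_actM -expgSr; exact: (B'orbit b bB).1.
  (* Acting by [t^-1] leaves the segment only at its start, where the backward half of the orbit
     bound takes over. *)
  case: i => [|i]; first by rewrite expg0 derived_act1; exact: (B'orbit b bB).2.
  by rewrite -derived_actM expgSr mulgK; exact: (B'orbit b bB).1.
- split; move: v B'v; apply: isolated_span_min;
    try exact: isolated_preim_act; move=> _ /allpairsPdep[b [i [bB _ ->]]] /=;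
    rewrite derived_actC; apply: B'B;
    by have [] := Bclosed s sT b (isolated_span_gen bB).
Qed.

(** An isolated span of finite rank that contains the commutators of the generators and is stable
    under conjugation is a normal subgroup with abelian quotient, so it is all of G'. *)
Lemma derived_finite_rank : finitely_generated [set: G] ->
  exists B : seq V, forall v, isolated_span B v.
Proof.
move=> [T TG].
pose B0 := [seq derived_mk mG (derived_commg s t) | s <- T, t <- T].
have [B [B0B Bclosed]] := isolated_span_act_closed B0 T.
have Biso := isolated_spanP B; exists B => v.
pose W := [set g | exists2 u : V, isolated_span B u & val u = g].
have actB g u : isolated_span B u -> isolated_span B (act g u).
  (* Stability under [g^-1] is built in so that [K] is closed under inverses. *)
  pose K := [set g | forall u, isolated_span B u ->
    isolated_span B (act g u) /\ isolated_span B (act g^-1 u)].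
  have Ksub : subgroup K.
    split=> [w Bw|x y Kx Ky w Bw]; first by rewrite invg1 derived_act1.
    rewrite invgF !derived_actM; split.
      by apply: (Ky _ _).2; exact: (Kx w Bw).1.
    by apply: (Kx _ _).2; exact: (Ky w Bw).1.
  have : [set: G] g by [].
  by rewrite -TG => /(generated_min Ksub Bclosed)/(_ u) Kg /Kg[].
have Wnorm : normal_subgroup W.
  split; first split.
  - by exists 0%R => //; exact: Biso.1.1.
  - move=> _ _ [u Bu <-] [w Bw <-]; exists (u - w)%R => //.
    exact: (zsubgroupB Biso.1).
  - by move=> _ g [u Bu <-]; exists (act g u) => //; exact: actB.
have Wcomm : forall x y, W [~ x, y].
  apply: (generated_commg Wnorm TG) => s t sT tT.
  exists (derived_mk mG (derived_commg s t)) => //; apply: B0B.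
  exact: allpairs_f.
have [u Bu uv] : W (val v).
  have := derived_val v; apply: (generated_min Wnorm.1).
  by move=> _ [x _ [y _ <-]]; exact: Wcomm.
by rewrite -(val_inj uv).
Qed.

End FiniteRank.

(** * Finite index *)

Section FiniteIndex.
Variable G : groupType.
Implicit Types (H M N : set G) (R S T U : seq G) (x y z u r : G).

Definition finite_index_in M N : Prop :=
  exists R, forall x, M x -> exists2 r, r \in R & N (x / r).

Lemma finite_index_trans H M N :
  finite_index_in H M -> finite_index_in M N -> finite_index_in H N.
Proof.
move=> [R1 R1P] [R2 R2P]; exists [seq r2 * r1 | r1 <- R1, r2 <- R2] => x Hx.
have [r1 r1R Mx] := R1P x Hx; have [r2 r2R Nx] := R2P _ Mx.
by exists (r2 * r1); [exact: allpairs_f|rewrite invgM mulgA].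
Qed.

Lemma conjg_expand N x y : subgroup N -> N [~ x, y] -> N x -> N (x ^ y).
Proof.
by move=> Nsub Nxy Nx; rewrite -(mulVKg x (x ^ y)) -commgEl; exact: (subgroupM Nsub).
Qed.

(** In the abelian quotient M/N, this adjoins to [N] the cyclic group generated by the torsion
    element [u]. *)
Lemma cyclic_extension M N u k : subgroup M -> subgroup N -> N `<=` M ->
    (forall x y, M x -> M y -> N [~ x, y]) ->
    M u -> (0 < k)%N -> N (u ^+ k) ->
  let N' := [set x | exists i, N (x / u ^+ i)] in
  [/\ subgroup N', N `<=` N', N' `<=` M, N' u & finite_index_in N' N].
Proof.
move=> Msub Nsub NM Mcomm Mu k0 Nuk N'.
have NJ x y : M y -> N x -> N (x ^ y).
  by move=> My Nx; apply: (conjg_expand Nsub) => //; apply: Mcomm => //; exact: NM.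
split.
- split=> [|x y [i Nx] [j Ny]]; first by exists 0%N; rewrite divgg; exact: Nsub.1.
  (* Modulo [N] the inverse of [u ^+ j] is [u ^+ (k.-1 * j)], because [u ^+ k] lies in [N]. *)
  pose l := (i + k.-1 * j)%N; exists l.
  have ul1 : u ^- i * u ^+ l * u ^- (k * j) * u ^+ j = 1.
    rewrite -mulgA; apply/eqP; rewrite mulg_eq1 invgM invgK; apply/eqP.
    rewrite /l expgnDr mulKg; apply: (@mulgI _ (u ^+ j)).
    by rewrite mulVKg -expgnDr -mulSn prednK.
  have -> : x / y / u ^+ l =
      x / u ^+ i * (u ^- (k * j) / (y / u ^+ j)) ^ u ^- l.
    by rewrite -[in LHS](mulg1 x) -ul1 conjgE invgF invgK !mulgA.
  apply: (subgroupM Nsub) => //; apply: NJ.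
    by apply: (subgroupV Msub); exact: (subgroupX _ Msub).
  apply: Nsub.2 => //; apply: (subgroupV Nsub).
  by rewrite expgnA; exact: (subgroupX _ Nsub).
- by move=> x Nx; exists 0%N; rewrite expg0 divg1.
- move=> x [i Nx]; rewrite -(mulgVK (u ^+ i) x); apply: (subgroupM Msub).
    exact: NM.
  exact: (subgroupX _ Msub).
- by exists 1%N; rewrite expg1 divgg; exact: Nsub.1.
- exists [seq u ^+ i | i <- iota 0 k] => x [i Nx]; exists (u ^+ (i %% k)).
    by apply: map_f; rewrite mem_iota add0n ltn_pmod.
  have -> : x / u ^+ (i %% k) = x / u ^+ i * u ^+ (i %/ k * k).
    by rewrite {2}(divn_eq i k) expgnDr invgM mulgA mulgVK.
  by apply: (subgroupM Nsub) => //; rewrite mulnC expgnA; exact: (subgroupX _ Nsub).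
Qed.

(** Climbing from [N] to [M] by adjoining one generator at a time, each step has finite index. *)
Lemma abelian_torsion_finite_index M N U : subgroup M -> subgroup N ->
    N `<=` M -> (forall x y, M x -> M y -> N [~ x, y]) ->
    finite_generating_set M U ->
    (forall u, u \in U -> exists2 k, (0 < k)%N & N (u ^+ k)) ->
  finite_index_in M N.
Proof.
move=> Msub Nsub NM Mcomm MU Utors.
have UM u : u \in U -> M u by move=> uU; rewrite -MU; exact: generated_gen.
(* This form no longer asks [U] to generate [M], so it admits induction on [U]. *)
suff [N' [N'sub _ UN' [R RP]]] : exists N', [/\ subgroup N', N `<=` N',
    forall u, u \in U -> N' u & finite_index_in N' N].
  exists R => x; rewrite -MU => Mx; apply: RP.
  exact: (generated_min N'sub UN').
elim: U {MU} UM N Nsub NM Mcomm Utors => [|u U ih] UM N Nsub NM Mcomm Utors.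
  by exists N; split=> //; exists [:: 1] => x Nx; exists 1; rewrite ?mem_head ?divg1.
have [k k0 Nuk] := Utors u (mem_head _ _).
have [] := cyclic_extension Msub Nsub NM Mcomm (UM u (mem_head _ _)) k0 Nuk.
set N1 := mkset _ => N1sub NN1 N1M N1u N1fi.
have inU v : v \in U -> v \in u :: U by rewrite in_cons => ->; rewrite orbT.
have [||v /inU/Utors[m m0 Nvm]|N' [N'sub N1N' UN' N'fi]] := ih _ N1 N1sub N1M.
- by move=> v /inU/UM.
- by move=> x y Mx My; apply: NN1; exact: Mcomm.
- by exists m => //; exact: NN1.
exists N'; split=> //; first by move=> x /NN1/N1N'.
  by move=> v; rewrite in_cons => /predU1P[->|/UN'//]; exact: N1N'.
exact: finite_index_trans N'fi N1fi.
Qed.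

(** Schreier rewriting: [U] collects the elements r t / r' of [M], for coset representatives r, r'
    and letters t. One such factor is spent per letter, so word length is preserved, which the
    distortion bound uses. *)
Lemma schreier M T : subgroup M -> finite_index_in [set: G] M ->
  exists U, (forall u, u \in U -> M u) /\
  forall s, {subset s <= T ++ [seq x^-1 | x <- T]} -> M (\prod_(x <- s) x) ->
    exists s', [/\ size s' = size s, {subset s' <= U} &
                   \prod_(x <- s') x = \prod_(x <- s) x].
Proof.
move=> Msub [R RP].
(* With 1 as the only representative in [M], the representative left over after rewriting a word of
   [M] is trivial. *)
pose R' := 1 :: [seq r <- R | ~~ `[< M r >]].
have R'P x : exists2 r, r \in R' & M (x / r).
  have [Mx|Mx] := pselect (M x); first by exists 1; rewrite ?mem_head// divg1.
  have [r rR Mxr] := RP x I; exists r => //.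
  rewrite in_cons mem_filter rR andbT; apply/orP; right; apply/asboolPn => Mr.
  by apply: Mx; rewrite -(mulgVK r x); exact: (subgroupM Msub).
have R'M r : r \in R' -> M r -> r = 1.
  by rewrite in_cons mem_filter => /predU1P[//|/andP[/asboolPn]].
pose L := T ++ [seq x^-1 | x <- T].
pose U := [seq u <- [seq x / r | x <- [seq r * t | r <- R', t <- L], r <- R']
                | `[< M u >]].
exists U; split=> [u|s sL Ms]; first by rewrite mem_filter => /andP[/asboolP].
(* Tails of the word need not lie in [M], so the induction carries a representative on either
   side. *)
suff : forall r, r \in R' -> exists s' r', [/\ size s' = size s,
    {subset s' <= U}, r' \in R' &
    r * \prod_(x <- s) x = \prod_(x <- s') x * r'].
  move=> /(_ 1 (mem_head _ _))[s' [r' [s'size s'U r'R']]]; rewrite mul1g => sE.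
  exists s'; split=> //; rewrite sE (R'M r' r'R') ?mulg1//.
  rewrite -(mulKg (\prod_(x <- s') x) r') -sE; apply: (subgroupM Msub) => //.
  apply: (subgroupV Msub); apply: (subgroup_prod Msub) => u /s'U.
  by rewrite mem_filter => /andP[/asboolP].
elim: s {Ms} sL => [|t s ih] sL r rR'.
  by exists [::], r; split => //; rewrite !big_nil mulg1 mul1g.
have [r1 r1R' Mr1] := R'P (r * t).
have [|s' [r' [s'size s'U r'R' sE]]] := ih _ r1 r1R'.
  by move=> x xs; apply: sL; rewrite in_cons xs orbT.
exists (r * t / r1 :: s'), r'; split=> //=; first by rewrite s'size.
  move=> x; rewrite in_cons => /predU1P[->|/s'U//].
  rewrite mem_filter; apply/andP; split; first exact/asboolP.
  by apply: allpairs_f => //; apply: allpairs_f => //; apply: sL; exact: mem_head.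
by rewrite !big_cons -mulgA -sE !mulgA mulgVK.
Qed.

Lemma schreier_generators M T : subgroup M -> finite_index_in [set: G] M ->
    finite_generating_set [set: G] T -> finitely_generated M.
Proof.
move=> Msub Mfi TG; have [U [UM UP]] := schreier T Msub Mfi.
exists U; apply/seteqP; split; first exact: generated_min.
move=> w Mw; have [n [s [_ sT sw]]] := generated_word TG (I : [set: G] w).
rewrite -sw in Mw *; have [s' [_ s'U <-]] := UP s sT Mw.
apply: (subgroup_prod (generated_subgroup _)) => x /s'U; exact: generated_gen.
Qed.

(** In the chain G > G'N > N both quotients are abelian and torsion; the middle group is finitely
    generated by Schreier, having finite index. *)
Lemma metabelian_torsion_finite_index N : finitely_generated [set: G] ->
    metabelian G -> normal_subgroup N ->
    (forall g, exists2 k, (0 < k)%N & N (g ^+ k)) ->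
  finite_index_in [set: G] N.
Proof.
move=> [T TG] mG [Nsub NJ] Ntors.
have [Dsub DJ] := derived_normal G.
pose P := [set x | exists2 n, N n & derived_subgroup G (x / n)].
have Psub : subgroup P.
  split=> [|x y [n Nn Dx] [m Nm Dy]].
    by exists 1; [exact: Nsub.1|rewrite divg1; exact: Dsub.1].
  exists (n / m); first exact: Nsub.2.
  have -> : x / y / (n / m) = x / n * (y / m)^-1 ^ (n / m)^-1.
    by rewrite /conjg !gnorm.
  by apply: (subgroupM Dsub) => //; apply: DJ; exact: (subgroupV Dsub).
have NP : N `<=` P by move=> n Nn; exists n => //; rewrite divgg; exact: Dsub.1.
have Pfi : finite_index_in [set: G] P.
  apply: (abelian_torsion_finite_index _ Psub _ _ TG) => //.
  - move=> x y _ _; exists 1; first exact: Nsub.1.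
    by rewrite divg1; exact: derived_commg.
  - by move=> u _; have [k k0 /NP] := Ntors u; exists k.
have [U UP] := schreier_generators Psub Pfi TG.
have NcommN n y : N n -> N [~ n, y].
  by move=> Nn; apply: (subgroupM Nsub); [exact: (subgroupV Nsub)|exact: NJ].
apply: (finite_index_trans Pfi).
apply: (abelian_torsion_finite_index Psub Nsub NP _ UP) => // x y.
move=> [n Nn Dx] [m Nm Dy].
(* Modulo [N] the commutator of [x] and [y] is that of [x / n] and [y / m], which lie in the abelian
   group G'. *)
rewrite -(mulgVK n x) commg_mull; apply: (subgroupM Nsub); last exact: NcommN.
apply: (NJ); rewrite -invgR -(mulgVK m y) commg_mull; apply: (subgroupV Nsub).
apply: (subgroupM Nsub); last exact: NcommN.
apply: (NJ); have -> : [~ y / m, x / n] = 1 by apply/eqP/commgP; exact: mG.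
exact: Nsub.1.
Qed.

End FiniteIndex.

(** * Distortion of normal self-embeddings *)

Section WordLengthBounds.
Variable G : groupType.
Implicit Types (H : set G) (S T : seq G) (x y w : G).

Lemma word_length_le S w n : word_of_length S w n -> (word_length S w <= n)%N.
Proof. by move=> wn; have [_] := word_lengthP (ex_intro _ n wn); exact. Qed.

Lemma word_of_length_prod S (f : G -> nat) (s : seq G) :
    (forall x, x \in s -> word_of_length S x (f x)) ->
  word_of_length S (\prod_(x <- s) x) (\sum_(x <- s) f x).
Proof.
elim: s => [|x s ih] xs; first by exists [::]; rewrite !big_nil.
have [r [rsize rS rx]] := xs x (mem_head _ _).
have [|r' [r'size r'S r's]] := ih.
  by move=> y ys; apply: xs; rewrite in_cons ys orbT.
exists (r ++ r'); rewrite !big_cons big_cat/= size_cat rsize r'size rx r's.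
by split=> // y; rewrite mem_cat => /orP[/rS|/r'S].
Qed.

Lemma word_length_prod H S C (s : seq G) : finite_generating_set H S ->
    (forall x, x \in s -> H x /\ (word_length S x <= C)%N) ->
  (word_length S (\prod_(x <- s) x) <= C * size s)%N.
Proof.
move=> SH sC; apply: (@leq_trans (\sum_(x <- s) word_length S x)).
  apply/word_length_le/word_of_length_prod => x /sC[Hx _].
  exact: (word_lengthP (generated_word SH Hx)).1.
rewrite big_seq -sum1_size big_distrr/= [leqRHS]big_seq; apply: leq_sum => x /sC[].
by rewrite muln1.
Qed.

(** Schreier rewriting turns a word in [T] into an equally long product of elements of [U], whose
    lengths over [S] are bounded. *)
Lemma distortion_linear T H S : finite_generating_set [set: G] T ->
    finite_generating_set H S -> finite_index_in [set: G] H ->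
  growth_le (distortion T H S) id.
Proof.
move=> TG SH Hfi.
have Hsub : subgroup H by rewrite -SH; exact: generated_subgroup.
have [U [UH UP]] := schreier T Hsub Hfi.
pose C := (\max_(u <- U) word_length S u)%N; exists C.+1 => // l.
have [[w [Hw wl <-]] _] := distortion_max l TG SH.
have [[s [ssize sT sw]] _] := word_lengthP (generated_word TG (I : [set: G] w)).
rewrite -sw in Hw; have [s' [s'size s'U s's]] := UP s sT Hw.
rewrite -sw -s's; apply: (@leq_trans (C * size s')).
  apply: (word_length_prod SH) => u /s'U uU; split; first exact: UH.
  exact: (@leq_bigmax_seq _ U xpredT (word_length S) u).
by rewrite s'size ssize; rewrite /=; nia.
Qed.

Lemma exists_word_length H S n : finite_generating_set H S ->
  infinite_set H -> exists2 w, H w & (n <= word_length S w)%N.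
Proof.
move=> SH Hinf; apply: contrapT => noword; apply: Hinf.
apply: sub_finite_set (finite_ball S n) => w Hw; exists (word_length S w).
  by rewrite leqNgt; apply/negP => /ltnW nw; apply: noword; exists w.
exact: (word_lengthP (generated_word SH Hw)).1.
Qed.

(** An infinite [H] has elements of arbitrarily large length. The first [l] letters of a geodesic
    word give length at least [l] over [S], but at most [C * l] over [T]. *)
Lemma distortion_ge_linear T H S : finite_generating_set [set: G] T ->
    finite_generating_set H S -> infinite_set H ->
  growth_le id (distortion T H S).
Proof.
move=> TG SH Hinf; pose L := S ++ [seq x^-1 | x <- S].
have Hsub : subgroup H by rewrite -SH; exact: generated_subgroup.
have LH x : x \in L -> H x.
  have SinH y : y \in S -> H y by move=> yS; rewrite -SH; exact: generated_gen.
  rewrite mem_cat => /orP[/SinH//|/mapP[y /SinH Hy ->]].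
  exact: (subgroupV Hsub).
pose C := (\max_(x <- L) word_length T x).+1; exists C => // l.
have [w Hw lw] := exists_word_length l SH Hinf.
have [[s [ssize sL sw]] wmin] := word_lengthP (generated_word SH Hw).
have tL x : x \in take l s -> x \in L by move=> /mem_take/sL.
have dL x : x \in drop l s -> x \in L by move=> /mem_drop/sL.
pose v := \prod_(x <- take l s) x.
have Hv : H v by apply: (subgroup_prod Hsub) => x /tL/LH.
have [[r [rsize rL rv]] _] := word_lengthP (generated_word SH Hv).
have lv : (l <= word_length S v)%N.
  (* A shorter word for the prefix [v] would shorten the geodesic word for [w]. *)
  suff : (word_length S w <= word_length S v + (word_length S w - l))%N.
    by move: lw; clear; lia.
  apply: wmin; exists (r ++ drop l s); rewrite size_cat rsize size_drop ssize.
  split=> // [x|]; first by rewrite mem_cat => /orP[/rL|/dL].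
  by rewrite big_cat/= rv -sw -[in RHS](cat_take_drop l s) big_cat.
have [_ Dmax] := distortion_max (C * l) TG SH.
rewrite (leq_trans lv)// (leq_trans _ (leq_pmull _ _))//; apply: Dmax => //.
apply: (@leq_trans (C * size (take l s))).
  apply: (word_length_prod TG) => x /tL xL; split=> //; apply: leqW.
  exact: (@leq_bigmax_seq _ L xpredT (word_length T) x).
by rewrite leq_mul2l size_take_min geq_minl orbT.
Qed.

End WordLengthBounds.

(** * The descending chain of iterated images *)

Section NormalSelfEmbedding.
Import GRing.Theory.
Variables (G : groupType) (mG : metabelian G) (phi : {multiplicative G -> G}).
Hypotheses (phi_inj : injective phi) (phi_normal : normal_subgroup (range phi)).
Local Notation V := (derived_module mG).
Local Notation D := (derived_subgroup G).
Local Notation K i := (range (iter i phi)).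

Lemma iter_morphM i : {morph iter i phi : x y / x * y}.
Proof. by elim: i => // i ih x y; rewrite !iterS ih gmulfM. Qed.

Lemma iter_morphF i : {morph iter i phi : x y / x / y}.
Proof.
by move=> x y; apply: (@mulIg _ (iter i phi y)); rewrite -iter_morphM !mulgVK.
Qed.

Lemma iter_morphX i n : {morph iter i phi : x / x ^+ n}.
Proof.
move=> x; elim: n => [|n ih]; last by rewrite !expgS iter_morphM ih.
by rewrite !expg0 -(divgg 1) iter_morphF !divgg.
Qed.

Lemma iter_morphJ i : {morph iter i phi : x y / x ^ y}.
Proof.
move=> x y; apply: (@mulgI _ (iter i phi y)).
by rewrite -iter_morphM -!conjgC iter_morphM.
Qed.

Lemma iter_inj i : injective (iter i phi).
Proof. by elim: i => // i ih x y; rewrite !iterS => /phi_inj/ih. Qed.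

Lemma range_iter_subgroup i : subgroup (K i).
Proof.
split=> [|_ _ [x _ <-] [y _ <-]].
  by exists (1 / 1) => //; rewrite iter_morphF divgg.
by exists (x / y) => //; rewrite iter_morphF.
Qed.

Lemma range_iter_anti i j : (i <= j)%N -> K j `<=` K i.
Proof.
by move=> ij _ [x _ <-]; exists (iter (j - i) phi x); rewrite // -iterD subnKC.
Qed.

(** [iter i phi] transports the normality of [range phi] in [G], which makes the chain subnormal. *)
Lemma range_iter_normal i x y : K i.+1 x -> K i y -> K i.+1 (x ^ y).
Proof.
move=> [x' _ <-] [y' _ <-]; rewrite iterSr -iter_morphJ.
have [z _ <-] : range phi (phi x' ^ y') by apply: phi_normal.2; exists x'.
by exists z => //; rewrite iterSr.
Qed.

Lemma expgM_mod (N : set G) x y n : subgroup N -> N y ->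
    (forall z, N z -> N (z ^ x)) ->
  exists2 z, N z & (x * y) ^+ n = x ^+ n * z.
Proof.
move=> Nsub Ny NJ; elim: n => [|n [z Nz xyn]].
  by exists 1; [exact: Nsub.1|rewrite !expg0 mulg1].
exists (z ^ x * y); first by apply: (subgroupM Nsub) => //; exact: NJ.
rewrite !expgSr xyn -2!mulgA; congr (_ * _).
by rewrite mulgA (conjgC z) -mulgA.
Qed.

Hypothesis G_fg : finitely_generated [set: G].
Hypothesis no_free : forall (a : V) g, ~ orbit_free a g.

Lemma abelianization_finite_rank :
  exists B : seq (abelianization G), forall q, isolated_span B q.
Proof.
have [T TG] := G_fg; exists [seq abel t | t <- T] => q.
have Bsub := (isolated_spanP [seq abel t | t <- T]).1.
rewrite -[q]abel_reprK; have : [set: G] (abel_repr q) by [].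
rewrite -TG; move: (abel_repr q).
apply: (@generated_min _ _ [set x | isolated_span _ (abel x)]).
  split=> [|x y /= Bx By]; first exact: Bsub.1.
  by rewrite abelM abelV; exact: (zsubgroupB Bsub).
by move=> t tT; apply: isolated_span_gen; exact: map_f.
Qed.

(* If [g] had infinite order modulo [phi(G)], so would [phi^i(g)] modulo
   [phi^(i+1)(G)] for all [i]; infinitely often this is witnessed in [G'], or
   almost always in the abelianization, against the finite rank of either. *)
Lemma range_torsion g : exists2 k, (0 < k)%N & range phi (g ^+ k).
Proof.
apply: contrapT => /forall2NP gtors.
pose h i := iter i phi g.
(* By injectivity, [iter i phi] pulls [K i.+1] back to [range phi], so the infinite order of [g] is
   inherited by [h i]. *)
have hK i k : (0 < k)%N -> ~ K i.+1 (h i ^+ k).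
  move=> k0 [x _]; rewrite iterSr /h -iter_morphX => /iter_inj xg.
  by case: (gtors k) => //; apply; exists x.
(* In the abelianization, [h i] has finite order modulo the image of [K i.+1]. *)
pose inA i := exists2 k, (0 < k)%N & exists2 y, K i.+1 y & D (h i ^+ k / y).
have hKi i : K i (h i) by exists g.
have [often|] := pselect (forall i, exists2 j, (i <= j)%N & inA j).
  have [B BV] := derived_finite_rank no_free G_fg.
  pose L i := [set v : V | K i (val v)].
  have Lsub i : zsubgroup (L i).
    split=> [|u v Ku Kv]; first exact: (range_iter_subgroup i).1.
    exact: (range_iter_subgroup i).2.
  apply: (@isolated_span_chain _ B L) => //.
    by move=> i j ij v; exact: (range_iter_anti ij).
  move=> i; have [j ij [k k0 [y Ky Da]]] := often i.
  set a := h j ^+ k / y in Da; have Ka : K j a.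
    apply: (range_iter_subgroup j).2; last exact: (range_iter_anti (leqnSn j) Ky).
    exact: (subgroupX _ (range_iter_subgroup j)).
  exists j.+1, (derived_mk mG Da); split => //; first exact: (range_iter_anti ij Ka).
  move=> m m0 Lm; have : L j.+1 (derived_mk mG Da *+ `|m|)%R.
    exact: (zsubgroup_absz (Lsub j.+1)).
  rewrite /L/= derived_valMn/= => Kam.
  (* Since [a * y = h j ^+ k] with [y] in [K j.+1], a positive power of [a] in [K j.+1] would force
     one of [h j] into it. *)
  have [z Kz] := expgM_mod `|m| (range_iter_subgroup j.+1) Ky
    (fun z Kz => range_iter_normal Kz Ka).
  rewrite /a mulgVK -expgnA => hE.
  apply: (hK j (k * `|m|)%N); first by rewrite muln_gt0 k0 absz_gt0.
  by rewrite hE; apply: (subgroupM (range_iter_subgroup j.+1)).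
move=> /existsNP[N rarely].
have [B BQ] := abelianization_finite_rank.
(* Starting at level [N], beyond which [inA] always fails, each [h (N + i)] witnesses a descent in
   the abelianization. *)
pose L i := [set abel x | x in K (N + i)%N].
have Lsub i : zsubgroup (L i).
  split=> [|_ _ [x Kx <-] [y Ky <-]].
    by exists 1 => //; exact: (range_iter_subgroup _).1.
  exists (x / y); first exact: (range_iter_subgroup _).2.
  by rewrite abelM abelV.
apply: (@isolated_span_chain _ B L) => //.
  move=> i j ij _ [x Kx <-]; exists x => //.
  by apply: range_iter_anti Kx; rewrite leq_add2l.
move=> i; exists i.+1, (abel (h (N + i))); split=> //; first by exists (h (N + i)%N).
move=> m m0 /(zsubgroup_absz (Lsub i.+1))[y Ky].
rewrite -abelX => /esym/abel_eq Dy; apply: rarely; exists (N + i)%N.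
  exact: leq_addr.
exists `|m|%N; first by rewrite absz_gt0.
by exists y => //; rewrite addnS in Ky.
Qed.

End NormalSelfEmbedding.

Theorem lemma2p5 (G : groupType) (phi : {multiplicative G -> G})
    (G_fg : finitely_generated [set: G]) (G_metabelian : metabelian G)
    (G_infinite : infinite_set [set: G])
    (phi_inj : injective phi) (phi_normal : normal_subgroup (range phi))
    (phi_distorted : distorted (range phi)) :
  exists H : set G, subgroup H /\ isomorphic_to_subgroup ZwrZ H.
Proof.
have [[a [g free]]|nofree] := pselect (exists (a : derived_module G_metabelian) g,
    orbit_free a g); first exact: orbit_free_wreath free.
have no_free (a : derived_module G_metabelian) g : ~ orbit_free a g.
  by move=> free; apply: nofree; exists a, g.
have [T [S [TG SH []]]] := phi_distorted.
have phi_fi := metabelian_torsion_finite_index G_fg G_metabelian phi_normal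
  (range_torsion phi_inj phi_normal G_fg no_free).
split; first exact: distortion_linear.
(* A finite image would make [G] finite, as [phi] is injective. *)
apply: distortion_ge_linear => // phi_finite; apply: G_infinite.
apply: sub_finite_set (finite_preimage (f := phi) _ phi_finite).
  by move=> x _; exists x.
by move=> x y _ _ /phi_inj.
Qed.
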